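(* Let $R$ be a commutative ring with identity, $S$ a multiplicatively closed subset of $R$, $M$ an $R$-module, and $P$ a submodule of $M$. Then: (a) If $S_1\subseteq S_2$ are multiplicatively closed subsets of $R$ and $P$ is an $S_1$-primary submodule of $M$, then $P$ is an $S_2$-primary submodule of $M$ in case $(P:_R M)\cap S_2=\emptyset$. (b) $P$ is an $S$-primary submodule of $M$ if and only if $P$ is an $S^{*}$-primary submodule of $M$. (c) If $P$ is an $S$-primary submodule of $M$, then $S^{-1}P$ is a primary submodule of the $S^{-1}R$-module $S^{-1}M$.
   Context: All rings are commutative with identity and all modules are unital. A multiplicatively closed subset $S$ of $R$ is a non-empty subset with $0\notin S$, $1\in S$, and $ss'\in S$ for all $s,s'\in S$. $(P:_R M)=\{r\in R : rM\subseteq P\}$, and $\sqrt{I}$ is the radical of an ideal $I$. A submodule $P$ of $M$ with $(P:_R M)\cap S=\emptyset$ is called $S$-primary if there exists $s\in S$ such that whenever $rm\in P$ with $r\in R$, $m\in M$, then $sr\in\sqrt{(P:_R M)}$ or $sm\in P$. A submodule $P$ of $M$ is primary if $P\ne M$ and whenever $rm\in P$ with $r\in R$, $m\in M$, then $r\in\sqrt{(P:_R M)}$ or $m\in P$. The saturation of $S$ is $S^{*}=\{x\in R : \frac{x}{1}\text{ is a unit of }S^{-1}R\}$; it is a multiplicatively closed subset of $R$ containing $S$. *)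

(* Defs.v *)
From HB Require Import structures.
From mathcomp Require Import all_boot all_algebra.
From mathcomp Require Import boolp classical_sets.
From mathcomp Require Import ring.

Set Implicit Arguments.
Unset Strict Implicit.
Unset Printing Implicit Defensive.

Import GRing.Theory.
Local Open Scope classical_set_scope.
Local Open Scope ring_scope.
Local Open Scope quotient_scope.

(* Since [1] lies in the set and [0] does not, a ring carrying such a set is
   nonzero, even though [comPzRingType] allows the zero ring. *)
Record mulset (R : comPzRingType) := MulSet {
  mulset_set :> set R;
  mulset_not0 : ~ mulset_set 0;
  mulset1 : mulset_set 1;
  mulsetM : forall s t, mulset_set s -> mulset_set t -> mulset_set (s * t)
}.

Section Localization.
Variables (R : comPzRingType) (S : mulset R).

Definition den1 : set_type S := SigSub (mem_set (mulset1 S)).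

Lemma denM_subproof (s t : set_type S) : sval s * sval t \in (S : set R).
Proof. by apply/mem_set/mulsetM; apply: set_mem; apply: valP. Qed.

Definition denM (s t : set_type S) : set_type S := SigSub (denM_subproof s t).

Lemma denP (s : set_type S) : (S : set R) (sval s).
Proof. exact: set_mem (valP s). Qed.

Section Module.
Variable M : lmodType R.

(* The pair (m, s) stands for the fraction m / s in S^-1 M, and two fractions
   m / s and n / t are equal when u (t m) = u (s n) for some u in S. *)
Definition loc_eq (x y : M * set_type S) : bool :=
  `[< exists2 u, (S : set R) u &
      u *: (sval y.2 *: x.1) = u *: (sval x.2 *: y.1) >].

Lemma loc_eq_refl : reflexive loc_eq.
Proof. by move=> x; apply/asboolP; exists 1; first exact: mulset1. Qed.

Lemma loc_eq_sym : symmetric loc_eq.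
Proof.
by move=> x y; apply/asboolP/asboolP => -[u Su e]; exists u => //; rewrite e.
Qed.

Lemma loc_eq_trans : transitive loc_eq.
Proof.
move=> [n t] [m s] [k v] /asboolP[u /= Su e] /asboolP[u' /= Su' e'].
apply/asboolP; exists (u * u' * sval t) => /=.
  by apply: mulsetM (denP t); apply: mulsetM.
rewrite !scalerA in e e' *.
rewrite (_ : _ * _ * _ = u' * sval v * (u * sval t)); last by ring.
rewrite -scalerA e scalerA.
rewrite (_ : _ * _ * _ = u * sval s * (u' * sval v)); last by ring.
by rewrite -scalerA e' scalerA; congr (_ *: _); ring.
Qed.

Canonical loc_equiv := EquivRel loc_eq loc_eq_refl loc_eq_sym loc_eq_trans.

Definition locmod : Type := {eq_quot loc_eq}.

HB.instance Definition _ : EqQuotient _ loc_eq locmod := EqQuotient.on locmod.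
HB.instance Definition _ := Choice.on locmod.

Definition mfrac (m : M) (s : set_type S) : locmod := \pi_locmod (m, s).

Lemma mfrac_eqP (m n : M) (s t : set_type S) :
  mfrac m s = mfrac n t <->
  exists2 u, (S : set R) u & u *: (sval t *: m) = u *: (sval s *: n).
Proof.
split=> [/eqP|e]; first by rewrite eqmodE => /asboolP.
by apply/eqP; rewrite eqmodE; apply/asboolP.
Qed.

Lemma mfracP (x : locmod) : exists m s, x = mfrac m s.
Proof. by elim/quotW: x => -[m s]; exists m, s. Qed.

Lemma mfrac_repr (x : locmod) : mfrac (repr x).1 (repr x).2 = x.
Proof. by rewrite /mfrac -surjective_pairing reprK. Qed.

Definition loc0 : locmod := mfrac 0 den1.
Definition locopp (x : locmod) : locmod := mfrac (- (repr x).1) (repr x).2.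
Definition locadd (x y : locmod) : locmod :=
  let: (m, s) := repr x in let: (n, t) := repr y in
  mfrac (sval t *: m + sval s *: n) (denM s t).

Lemma locoppE m s : locopp (mfrac m s) = mfrac (- m) s.
Proof.
have /mfrac_eqP[u Su e] := mfrac_repr (mfrac m s).
by apply/mfrac_eqP; exists u => //; rewrite !scalerN e.
Qed.

Lemma locaddE m s n t :
  locadd (mfrac m s) (mfrac n t) = mfrac (sval t *: m + sval s *: n) (denM s t).
Proof.
rewrite /locadd.
case: (repr (mfrac m s)) (mfrac_repr (mfrac m s)) => m' s' /= /mfrac_eqP[u Su e].
case: (repr (mfrac n t)) (mfrac_repr (mfrac n t)) => n' t' /= /mfrac_eqP[v Sv f].
apply/mfrac_eqP; exists (u * v); first exact: mulsetM.
rewrite /= !scalerDr !scalerA in e f *; congr (_ + _).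
  rewrite (_ : _ * _ * _ = v * sval t * sval t' * (u * sval s)); last by ring.
  by rewrite -scalerA e scalerA; congr (_ *: _); ring.
rewrite (_ : _ * _ * _ = u * sval s * sval s' * (v * sval t)); last by ring.
by rewrite -scalerA f scalerA; congr (_ *: _); ring.
Qed.

Lemma mfrac_congr m n (s t : set_type S) :
  m = n -> sval s = sval t -> mfrac m s = mfrac n t.
Proof. by move=> -> /val_inj->. Qed.

Lemma locaddA : associative locadd.
Proof.
move=> x y z; have [m [s ->]] := mfracP x; have [n [t ->]] := mfracP y.
have [k [v ->]] := mfracP z; rewrite !locaddE; apply: mfrac_congr => /=.
  by rewrite !scalerDr !scalerA addrA; congr (_ *: _ + _ *: _ + _); ring.
by rewrite mulrA.
Qed.

Lemma locaddC : commutative locadd.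
Proof.
move=> x y; have [m [s ->]] := mfracP x; have [n [t ->]] := mfracP y.
rewrite !locaddE; apply: mfrac_congr => /=; first exact: addrC.
exact: mulrC.
Qed.

Lemma locadd0 : left_id loc0 locadd.
Proof.
move=> x; have [m [s ->]] := mfracP x; rewrite locaddE.
by apply: mfrac_congr; rewrite /= ?scaler0 ?add0r ?scale1r ?mul1r.
Qed.

Lemma locaddN : left_inverse loc0 locopp locadd.
Proof.
move=> x; have [m [s ->]] := mfracP x; rewrite locoppE locaddE.
apply/mfrac_eqP; exists 1; first exact: mulset1.
by rewrite /= scalerN addNr !scaler0.
Qed.

HB.instance Definition _ :=
  GRing.isZmodule.Build locmod locaddA locaddC locadd0 locaddN.

Lemma mfracD m s n t :
  mfrac m s + mfrac n t = mfrac (sval t *: m + sval s *: n) (denM s t).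
Proof. exact: locaddE. Qed.

Lemma mfrac0 s : mfrac 0 s = 0.
Proof.
by apply/mfrac_eqP; exists 1; rewrite ?scaler0 //; first exact: mulset1.
Qed.

Lemma mfrac_reduce (a : R) m (s t : set_type S) :
  sval s = a * sval t -> mfrac (a *: m) s = mfrac m t.
Proof.
move=> e; apply/mfrac_eqP; exists 1; first exact: mulset1.
by rewrite e !scalerA; congr (_ *: _); ring.
Qed.

End Module.

(* The localization S^-1 R: its additive group is that of S^-1 M for M := R. *)
Definition locring : Type := locmod R^o.

HB.instance Definition _ := GRing.Zmodule.on locring.

Definition rfrac (r : R) (s : set_type S) : locring := @mfrac R^o r s.

Definition to_loc (r : R) : locring := rfrac r den1.

Definition locscale (M : lmodType R) (x : locring) (y : locmod M) : locmod M :=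
  let: (r, s) := repr x in let: (m, t) := repr y in
  mfrac (r *: m) (denM s t).

Lemma locscaleE (M : lmodType R) r s (m : M) t :
  locscale (rfrac r s) (mfrac m t) = mfrac (r *: m) (denM s t).
Proof.
rewrite /locscale /rfrac.
case: (repr (@mfrac R^o r s)) (mfrac_repr (@mfrac R^o r s)) => r' s' /=.
move=> /mfrac_eqP[u Su e].
case: (repr (mfrac m t)) (mfrac_repr (mfrac m t)) => m' t' /= /mfrac_eqP[v Sv f].
apply/mfrac_eqP; exists (u * v); first exact: mulsetM.
have {}e : u * (sval s * r') = u * (sval s' * r) by exact: e.
rewrite /= !scalerA in f *.
rewrite (_ : _ * _ = (u * (sval s * r')) * (v * sval t)); last by ring.
by rewrite -scalerA f scalerA e; congr (_ *: _); ring.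
Qed.

Definition loc1 : locring := rfrac 1 den1.
Definition locmul (x y : locring) : locring := @locscale R^o x y.

Lemma locmulE r s r' s' :
  locmul (rfrac r s) (rfrac r' s') = rfrac (r * r') (denM s s').
Proof. exact: (@locscaleE R^o). Qed.

Lemma rfracP (x : locring) : exists r s, x = rfrac r s.
Proof. exact: (@mfracP R^o). Qed.

Lemma rfracD r s r' s' :
  rfrac r s + rfrac r' s' = rfrac (sval s' * r + sval s * r') (denM s s').
Proof. exact: (@mfracD R^o). Qed.

Lemma rfrac_eqP (r r' : R) (s s' : set_type S) :
  rfrac r s = rfrac r' s' <->
  exists2 u, (S : set R) u & u * (sval s' * r) = u * (sval s * r').
Proof. exact: (@mfrac_eqP R^o). Qed.

Lemma rfrac_congr r r' (s s' : set_type S) :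
  r = r' -> sval s = sval s' -> rfrac r s = rfrac r' s'.
Proof. exact: (@mfrac_congr R^o). Qed.

Lemma locmulA : associative locmul.
Proof.
move=> x y z; have [a [s ->]] := rfracP x; have [b [t ->]] := rfracP y.
have [c [v ->]] := rfracP z; rewrite !locmulE.
by apply: rfrac_congr; rewrite /= mulrA.
Qed.

Lemma locmulC : commutative locmul.
Proof.
move=> x y; have [a [s ->]] := rfracP x; have [b [t ->]] := rfracP y.
by rewrite !locmulE; apply: rfrac_congr; rewrite /= mulrC.
Qed.

Lemma locmul1 : left_id loc1 locmul.
Proof.
move=> x; have [a [s ->]] := rfracP x.
by rewrite locmulE; apply: rfrac_congr; rewrite /= mul1r.
Qed.

Lemma locmulDl : left_distributive locmul +%R.
Proof.
move=> x y z; have [a [s ->]] := rfracP x; have [b [t ->]] := rfracP y.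
have [c [v ->]] := rfracP z; rewrite !(rfracD, locmulE).
apply/rfrac_eqP; exists 1; first exact: mulset1.
by rewrite /=; ring.
Qed.

Lemma loc1_neq0 : loc1 != 0.
Proof.
apply/eqP => /rfrac_eqP[u Su]; rewrite /= !mul1r mulr1 mulr0 => u0.
by apply: (@mulset_not0 _ S); rewrite -u0.
Qed.

HB.instance Definition _ := GRing.Zmodule_isComNzRing.Build locring
  locmulA locmulC locmul1 locmulDl loc1_neq0.

Lemma rfracM r s r' s' :
  rfrac r s * rfrac r' s' = rfrac (r * r') (denM s s').
Proof. exact: locmulE. Qed.

Lemma locring1E : 1 = rfrac 1 den1. Proof. by []. Qed.

(* Classically every commutative ring has decidable units, which gives
   S^-1 R the library's notion of unit. *)
Definition locunit (x : locring) : bool := `[< exists y, y * x = 1 >].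
Definition locinv (x : locring) : locring :=
  if pselect (exists y, y * x = 1) is left h then projT1 (cid h) else x.

Lemma locmulV : {in locunit, left_inverse 1 locinv *%R}.
Proof.
move=> x /asboolP h; rewrite /locinv; case: pselect => // h'.
exact: projT2 (cid h').
Qed.

Lemma locunitP (x y : locring) : y * x = 1 -> locunit x.
Proof. by move=> h; apply/asboolP; exists y. Qed.

Lemma locinv_out : {in [predC locunit], locinv =1 id}.
Proof. by move=> x /asboolPn h; rewrite /locinv; case: pselect. Qed.

HB.instance Definition _ := GRing.ComNzRing_hasMulInverse.Build locring
  locmulV locunitP locinv_out.

Lemma rfrac_unitP r s :
  reflect (exists a, (S : set R) (a * r)) (rfrac r s \is a GRing.unit).
Proof.
apply: (iffP (asboolP _)) => [[y]|[a Sar]].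
  have [b [t ->]] := rfracP y; rewrite rfracM locring1E => /rfrac_eqP[u Su].
  rewrite /= mul1r mulr1 => e; exists (u * b); rewrite -mulrA e.
  by apply: mulsetM => //; exact: mulsetM (denP _) (denP _).
exists (rfrac (a * sval s) (SigSub (mem_set Sar))).
rewrite rfracM locring1E; apply/rfrac_eqP; exists 1; first exact: mulset1.
by rewrite /=; ring.
Qed.

Section LocalizedModule.
Variable M : lmodType R.

Lemma locscaleA (x y : locring) (z : locmod M) :
  locscale x (locscale y z) = locscale (x * y) z.
Proof.
have [a [s ->]] := rfracP x; have [b [t ->]] := rfracP y.
have [m [v ->]] := mfracP z; rewrite !(rfracM, locscaleE).
by apply: mfrac_congr; rewrite /= ?scalerA ?mulrA.
Qed.

Lemma locscale1 : left_id 1 (@locscale M).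
Proof.
move=> z; have [m [v ->]] := mfracP z; rewrite locring1E locscaleE.
by apply: mfrac_congr; rewrite /= ?scale1r ?mul1r.
Qed.

Lemma locscaleDr : right_distributive (@locscale M) +%R.
Proof.
move=> x y z; have [a [s ->]] := rfracP x; have [n [t ->]] := mfracP y.
have [m [v ->]] := mfracP z; rewrite !(locscaleE, mfracD).
apply/mfrac_eqP; exists 1; first exact: mulset1.
rewrite /= !scale1r !scalerDr !scalerA.
by congr (_ *: _ + _ *: _); ring.
Qed.

Lemma locscaleDl (z : locmod M) :
  {morph (fun x : locring => locscale x z) : x y / x + y}.
Proof.
move=> x y; have [a [s ->]] := rfracP x; have [b [t ->]] := rfracP y.
have [m [v ->]] := mfracP z; rewrite !(rfracD, locscaleE, mfracD).
apply/mfrac_eqP; exists 1; first exact: mulset1.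
by rewrite /= !scalerDr !scalerA -scalerDl; congr (_ *: _); ring.
Qed.

HB.instance Definition _ := GRing.Zmodule_isLmodule.Build locring (locmod M)
  locscaleA locscale1 locscaleDr locscaleDl.

Lemma mfracZ r s (m : M) t :
  rfrac r s *: mfrac m t = mfrac (r *: m) (denM s t).
Proof. exact: locscaleE. Qed.

(* S^-1 P, identified with its image under the injection into S^-1 M. *)
Definition locsub (P : set M) : set (locmod M) :=
  [set x | exists p s, P p /\ x = mfrac p s].

End LocalizedModule.

Definition saturation_set : set R := [set x | to_loc x \is a GRing.unit].

Lemma saturation_not0 : ~ saturation_set 0.
Proof.
by move=> /rfrac_unitP[a]; rewrite mulr0; exact: mulset_not0.
Qed.

Lemma sub_saturation : (S : set R) `<=` saturation_set.
Proof. by move=> s Ss; apply/rfrac_unitP; exists 1; rewrite mul1r. Qed.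

Lemma saturation1 : saturation_set 1.
Proof. exact/sub_saturation/mulset1. Qed.

Lemma saturationM x y :
  saturation_set x -> saturation_set y -> saturation_set (x * y).
Proof.
move=> /rfrac_unitP[a Sa] /rfrac_unitP[b Sb]; apply/rfrac_unitP.
by exists (a * b); rewrite mulrACA; exact: mulsetM.
Qed.

Definition saturation : mulset R :=
  MulSet saturation_not0 saturation1 saturationM.

End Localization.

Section Primary.
Variables (R : comPzRingType) (M : lmodType R).

(* The residual (P :_R M). *)
Definition colon (P : set M) : set R := [set r | forall m : M, P (r *: m)].

Definition radical (I : set R) : set R :=
  [set r | exists2 n, (0 < n)%N & I (r ^+ n)].

Definition primary (P : set M) : Prop :=
  [/\ submod_closed (mem P), P <> setT &
      forall (r : R) (m : M), P (r *: m) -> radical (colon P) r \/ P m].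

Definition S_primary (S : mulset R) (P : set M) : Prop :=
  [/\ submod_closed (mem P), colon P `&` S = set0 &
      exists2 s, (S : set R) s &
        forall (r : R) (m : M), P (r *: m) ->
          radical (colon P) (s * r) \/ P (s *: m)].

End Primary.

(* Main.v *)
(* Every x in S^* divides some ax in S, and both the radical of (P : M) and P
   absorb multiplication by a; this gives (b).  For (c), m/t lies in S^-1 P
   iff u m lies in P for some u in S.  So if (r/t)(m/v) lies in S^-1 P, some
   (ur)m lies in P, and S-primarity gives (sur)^n M <= P, hence r/t lies in
   the radical of (S^-1 P : S^-1 M), or s m in P, hence m/v in S^-1 P.
   Properness of S^-1 P is the case r = 1: were it everything, s m would lie
   in P for every m, so that s would lie in both (P : M) and S. *)
Require Import Defs.
From HB Require Import structures.
From mathcomp Require Import all_boot all_algebra.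
From mathcomp Require Import boolp classical_sets.

Set Implicit Arguments.
Unset Strict Implicit.
Unset Printing Implicit Defensive.

Import GRing.Theory.
Local Open Scope classical_set_scope.
Local Open Scope ring_scope.

(** Bridges boolean membership in [mem P] and propositional membership in [P]. *)
Lemma submod_closedP (R : pzRingType) (M : lmodType R) (P : set M) :
  submod_closed (mem P) <->
  P 0 /\ forall (a : R) u v, P u -> P v -> P (a *: u + v).
Proof.
split=> -[P0 PL]; split; [exact: set_mem | | exact: mem_set |].
- by move=> a u v Pu Pv; apply/set_mem/PL; apply: mem_set.
- by move=> a u v Pu Pv; apply: mem_set; apply: PL; apply: set_mem.
Qed.

Lemma mulsetX (R : comPzRingType) (S : mulset R) s n :
  (S : set R) s -> (S : set R) (s ^+ n).
Proof.
move=> Ss; elim: n => [|n IHn]; first by rewrite expr0; exact: mulset1.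
by rewrite exprS; exact: mulsetM.
Qed.

Section Submodule.
Variables (R : comPzRingType) (M : lmodType R) (P : set M).
Hypothesis P_submod : submod_closed (mem P).

Lemma submodZ (a : R) (m : M) : P m -> P (a *: m).
Proof.
have /submod_closedP[P0 PL] := P_submod.
by move=> Pm; rewrite -[_ *: _]addr0; exact: PL.
Qed.

Lemma colonMl (a r : R) : colon P r -> colon P (a * r).
Proof. by move=> Pr m; rewrite -scalerA; exact: submodZ. Qed.

Lemma radical_colonMl (a r : R) :
  radical (colon P) r -> radical (colon P) (a * r).
Proof.
by move=> [n n_gt0 Pr]; exists n => //; rewrite exprMn; exact: colonMl.
Qed.

Lemma colonI0_radical (S : mulset R) (s : R) :
  colon P `&` S = set0 -> (S : set R) s -> ~ radical (colon P) s.
Proof.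
rewrite -subset0 => PS0 Ss [n _ Psn]; apply: (PS0 (s ^+ n)).
by split=> //; exact: mulsetX.
Qed.

(** A common element [x] would have a multiple [a * x] in [S], still in the ideal [colon P]. *)
Lemma colonI0_saturation (S : mulset R) :
  colon P `&` S = set0 -> colon P `&` saturation S = set0.
Proof.
rewrite -!subset0 => PS0 x [Px /rfrac_unitP[a Sax]].
by apply: (PS0 (a * x)); split=> //; exact: colonMl.
Qed.

End Submodule.

Lemma S_primary_sub (R : comPzRingType) (M : lmodType R) (P : set M)
    (S1 S2 : mulset R) :
  (S1 : set R) `<=` (S2 : set R) -> S_primary S1 P ->
  colon P `&` S2 = set0 -> S_primary S2 P.
Proof.
by move=> S12 [P_submod _ [s S1s Ps]] PS2; split=> //; exists s; [exact: S12|].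
Qed.

Lemma S_primary_saturation (R : comPzRingType) (S : mulset R) (M : lmodType R)
    (P : set M) :
  S_primary S P <-> S_primary (saturation S) P.
Proof.
split=> [SP|[P_submod PS0 [s /rfrac_unitP[a Sas] Ps]]].
  case: (SP) => P_submod PS0 _.
  apply: S_primary_sub SP _; first exact: sub_saturation.
  exact: colonI0_saturation.
split=> //.
  by apply: subsetI_eq0 PS0 => //; exact: sub_saturation.
(* The witness [s] lies only in the saturation; its multiple [a * s] lies in [S]. *)
exists (a * s) => // r m /Ps[Psr|Psm]; [left|right].
  by rewrite -mulrA; exact: radical_colonMl.
by rewrite -scalerA; exact: submodZ.
Qed.

Section Localization.
Variables (R : comPzRingType) (S : mulset R) (M : lmodType R) (P : set M).
Hypothesis P_submod : submod_closed (mem P).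

(** The denominator stays unspecified because membership in [locsub P] depends only on the
    numerator. *)
Lemma rfracX (r : R) (t : set_type S) n :
  exists t' : set_type S, rfrac r t ^+ n = rfrac (r ^+ n) t'.
Proof.
elim: n => [|n [t' IHn]]; first by exists (den1 S); rewrite !expr0 locring1E.
by exists (denM t t'); rewrite !exprS IHn rfracM.
Qed.

(** A fraction in [locsub P] may be written with a numerator outside [P]; the factor [u] accounts
    for this. *)
Lemma locsub_mfracP (m : M) (t : set_type S) :
  locsub P (mfrac m t) <-> exists2 u, (S : set R) u & P (u *: m).
Proof.
split=> [[p [w [Pp /mfrac_eqP[u Su e]]]]|[u Su Pum]].
  exists (u * sval w); first exact: mulsetM (denP w).
  by rewrite -scalerA e; do 2!apply: submodZ => //.
(* Expand the fraction by [u]: m / t = (u m) / (u t). *)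
exists (u *: m), (denM (SigSub (mem_set Su)) t); split=> //.
by rewrite (@mfrac_reduce _ _ _ u m _ t).
Qed.

Lemma submod_closed_locsub :
  @submod_closed (locring S) (locmod S M) (mem (locsub P)).
Proof.
have /submod_closedP[P0 PL] := P_submod.
apply/submod_closedP; split; first by exists 0, (den1 S).
move=> x _ _ [p [t [Pp ->]]] [q [v [Pq ->]]]; have [r [w ->]] := rfracP x.
rewrite mfracZ mfracD; do 2!eexists; split; last by [].
by apply: PL => //; do 2!apply: submodZ => //.
Qed.

(** The same exponent [n] serves: (u r)^n m = u^n (r^n m) lies in [P], and u^n is in [S]. *)
Lemma radical_colon_locsub (u r : R) (t : set_type S) :
  (S : set R) u -> radical (colon P) (u * r) ->
  radical (@colon (locring S) (locmod S M) (locsub P)) (rfrac r t).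
Proof.
move=> Su [n n_gt0 Pur]; exists n => // x; have [m [v ->]] := mfracP x.
have [t' ->] := rfracX r t n; rewrite mfracZ.
apply/locsub_mfracP; exists (u ^+ n); first exact: mulsetX.
by rewrite scalerA -exprMn; exact: Pur.
Qed.

End Localization.

Lemma S_primary_locsub (R : comPzRingType) (S : mulset R) (M : lmodType R)
    (P : set M) :
  S_primary S P -> @primary (locring S) (locmod S M) (locsub P).
Proof.
move=> [P_submod PS0 [s Ss Ps]]; split; first exact: submod_closed_locsub.
- move=> PT; move: (PS0); rewrite -subset0 => /(_ s); apply; split=> // m.
  (* It remains to put [s *: m] in [P]. From m / 1 comes [u *: m] in [P]; the alternative that
     [s * u] is in the radical fails, as [s * u] is in [S]. *)
  have : locsub P (mfrac m (den1 S)) by rewrite PT.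
  move=> /(locsub_mfracP P_submod)[u Su /Ps[]//].
  by move=> /(colonI0_radical PS0); case; exact: mulsetM.
- move=> x y; have [r [t ->]] := rfracP x; have [m [v ->]] := mfracP y.
  rewrite mfracZ => /(locsub_mfracP P_submod)[u Su].
  rewrite scalerA => /Ps[]; [left|right].
    (* Regroup s (u r) as (s u) r, so that the factor in front of [r] lies in [S]. *)
    by apply: (@radical_colon_locsub _ _ _ _ P_submod (s * u));
      [exact: mulsetM | rewrite -mulrA].
  by apply/(locsub_mfracP P_submod); exists s.
Qed.

Theorem proposition2p7 (R : comPzRingType) (S : mulset R) (M : lmodType R)
    (P : set M) (P_submod : submod_closed (mem P)) :
  [/\ (forall S1 S2 : mulset R, (S1 : set R) `<=` (S2 : set R) ->
         S_primary S1 P -> colon P `&` S2 = set0 -> S_primary S2 P),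
      (S_primary S P <-> S_primary (saturation S) P) &
      (S_primary S P -> @primary (locring S) (locmod S M) (locsub P))].
Proof.
split; first by move=> S1 S2; exact: S_primary_sub.
  exact: S_primary_saturation.
exact: S_primary_locsub.
Qed.
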